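(* For any finite relational vocabulary $\tau$, any MD-logic based on a finite set $A\subseteq[0,1]$ of truth-values, and any MD-sentence $\langle\phi_1,\ldots,\phi_n;S\rangle$, either $\langle\phi_1,\ldots,\phi_n;S\rangle$ is almost surely satisfied by all finite models or $\langle\phi_1,\ldots,\phi_n;S\rangle$ is almost surely not satisfied in all finite models.
   Context: Fix a finite algebra $\mathbf A=\langle A,\wedge^{\mathbf A},\vee^{\mathbf A},\&^{\mathbf A},\to^{\mathbf A},0^{\mathbf A},1^{\mathbf A}\rangle$ with $A\subseteq[0,1]$ finite (for example finitely-valued Łukasiewicz or Gödel algebras). An $A$-valued model $\mathfrak M$ with non-empty domain $M$ interprets each $n$-ary predicate $R\in\tau$ by a map $R_{\mathfrak M}\colon M^n\to A$. Truth-values of formulas are defined inductively: connectives are interpreted by the corresponding operations of $\mathbf A$, and $\forall$, $\exists$ by the minimum, respectively maximum, of the truth-values of the instances over $M$. Here an MD-sentence is an expression $\langle\phi_1,\ldots,\phi_n;S\rangle$ where $\phi_1,\ldots,\phi_n$ are first-order sentences over $\tau$ and $S\subseteq A^n$; a model $\mathfrak M$ satisfies it if the tuple of the truth-values of $\phi_1,\ldots,\phi_n$ in $\mathfrak M$ belongs to $S$. The MD-sentence is almost surely satisfied if the fraction of $A$-valued models for $\tau$ with domain $\{1,\ldots,m\}$ that satisfy it tends to $1$ as $m\to\infty$; it is almost surely not satisfied if this fraction tends to $0$ as $m\to\infty$.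
   Formalization: Predicates of the vocabulary are required to have arity at least 1; with a nullary predicate P and A = {0,1}, the MD-sentence ⟨P;{1}⟩ is satisfied by exactly half of the models of every size, so the claim fails. *)

(* Defs.v *)
From HB Require Import structures.
From mathcomp Require Import all_boot all_order all_algebra finmap.
From mathcomp Require Import all_classical all_reals all_analysis.
Set Implicit Arguments.
Unset Strict Implicit.
Unset Printing Implicit Defensive.
Import Order.TTheory GRing.Theory Num.Theory.
Import numFieldNormedType.Exports.
Local Open Scope classical_set_scope.
Local Open Scope ring_scope.

(* The operations are arbitrary; only the order inherited from [0, 1] matters
   for the quantifiers. *)
Record algebra (R : realType) := Algebra {
  carrier :> {fset R};
  carrier_unit : forall a : R, a \in carrier -> 0 <= a <= 1;
  alg_meet : carrier -> carrier -> carrier;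
  alg_join : carrier -> carrier -> carrier;
  alg_conj : carrier -> carrier -> carrier;
  alg_imp : carrier -> carrier -> carrier;
  alg_zero : carrier;
  alg_one : carrier }.

(* Arities are positive: a nullary predicate is a propositional constant, whose
   truth-value is uniformly distributed on A for every size of the domain, so
   it has no zero-one law when A has at least two elements. *)
Record vocabulary := Vocabulary {
  symbol :> finType;
  arity : symbol -> nat;
  arity_gt0 : forall r : symbol, (0 < arity r)%N }.

(* Well-scoped de Bruijn syntax: [formula tau k] has its free variables among
   'I_k, and a quantifier binds variable 0 of its body. *)
Inductive formula (tau : vocabulary) : nat -> Type :=
| FAtom k (r : tau) (t : (arity r).-tuple 'I_k) : formula tau k
| FMeet k (f g : formula tau k) : formula tau k
| FJoin k (f g : formula tau k) : formula tau k
| FConj k (f g : formula tau k) : formula tau k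
| FImp k (f g : formula tau k) : formula tau k
| FZero k : formula tau k
| FOne k : formula tau k
| FForall k (f : formula tau k.+1) : formula tau k
| FExists k (f : formula tau k.+1) : formula tau k.

Definition sentence (tau : vocabulary) := formula tau 0.

Section Semantics.
Variables (R : realType) (A : algebra R) (tau : vocabulary).

Definition model (M : Type) := forall r : tau, (arity r).-tuple M -> A.

(* The least and greatest elements of a set of truth-values; a finite
   nonempty set has them, and the default value given to [arg min] and
   [arg max] is returned only on the empty set. *)
Definition least (V : set A) : A :=
  [arg min_(a < alg_one A | `[< V a >]) val a]%O.
Definition greatest (V : set A) : A :=
  [arg max_(a > alg_zero A | `[< V a >]) val a]%O.

Fixpoint value (M : Type) (I : model M) (k : nat) (f : formula tau k) :
    k.-tuple M -> A :=
  match f in formula _ k return k.-tuple M -> A with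
  | FAtom _ r t => fun e => I r [tuple of map (tnth e) t]
  | FMeet _ f g => fun e => alg_meet (value I f e) (value I g e)
  | FJoin _ f g => fun e => alg_join (value I f e) (value I g e)
  | FConj _ f g => fun e => alg_conj (value I f e) (value I g e)
  | FImp _ f g => fun e => alg_imp (value I f e) (value I g e)
  | FZero _ => fun=> alg_zero A
  | FOne _ => fun=> alg_one A
  | FForall _ f => fun e => least (range (fun x => value I f [tuple of x :: e]))
  | FExists _ f =>
      fun e => greatest (range (fun x => value I f [tuple of x :: e]))
  end.

Definition sentence_value (M : Type) (I : model M) (f : sentence tau) : A :=
  value I f [tuple].

Record md_sentence := MDSentence {
  md_size : nat;
  md_components : md_size.-tuple (sentence tau);
  md_values : {set md_size.-tuple A} }.

Definition satisfies (M : Type) (I : model M) (s : md_sentence) : bool :=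
  [tuple of map (sentence_value I) (md_components s)] \in md_values s.

(* The finite type of A-valued models with domain of size m, for counting. *)
Definition fin_model (m : nat) :=
  {dffun forall r : tau, {ffun (arity r).-tuple 'I_m -> A}}.

Definition model_of (m : nat) (I : fin_model m) : model 'I_m :=
  fun r t => I r t.

(* The domain is nonempty for m > 0, and the value at m = 0 does not affect
   the limits below. *)
Definition fraction (s : md_sentence) (m : nat) : R :=
  #|[set I : fin_model m | satisfies (model_of I) s]%SET|%:R
    / #|{: fin_model m}|%:R.

Definition almost_surely_satisfied (s : md_sentence) : Prop :=
  fraction s m @[m --> \oo] --> (1 : R).

Definition almost_surely_not_satisfied (s : md_sentence) : Prop :=
  fraction s m @[m --> \oo] --> (0 : R).

End Semantics.

(* Main.v *)
Require Import Defs.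
From mathcomp Require Import all_boot all_order all_algebra finmap.
From mathcomp Require Import all_classical all_reals all_analysis.
From mathcomp Require Import ring lra.
Set Implicit Arguments.
Unset Strict Implicit.
Unset Printing Implicit Defensive.
Import Order.TTheory GRing.Theory Num.Theory.
Import numFieldNormedType.Exports.
Local Open Scope classical_set_scope.
Local Open Scope ring_scope.

(** The proof is the extension-axiom argument for zero-one laws, with an
    arbitrary finite set of truth-values in place of two. Call a model [rich]
    up to [K] if, for all [k < K] parameters and every prescription of the
    truth-values of the atomic formulas that relate a further element to these
    parameters, some element other than the parameters meets the prescription.

    Any two models that are rich up to [K] give the same value to every sentence
    of width at most [K] ([sentence_value_rich]). In such models a partial
    isomorphism extends to any further element on either side
    ([partial_iso_forth], [partial_iso_back]), so corresponding assignments give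
    every formula the same value ([value_partial_iso]). Nothing is asked of the
    connectives, and of the quantifiers only that they depend on the set of
    values of the instances.

    Almost all finite models are rich ([cvg_not_rich]). For fixed parameters and
    a fixed pattern, different candidates are constrained on disjoint parts of
    the model, so each of them succeeds with at least some fixed probability
    [1 / Q], whatever happens at the others ([card_unrealized_cons]). All
    the [m - k] candidates outside the parameters fail with probability at most
    [(1 - 1 / Q) ^ (m - k)], and this beats the polynomial number [m ^ k] of
    choices of parameters ([cvg_natr_expr]).

    In particular a rich model exists, and almost all models satisfy the given
    MD-sentence exactly when that one does. *)

(** * Back-and-forth between rich models *)

Section PartialIsomorphism.
Variables (R : realType) (A : algebra R) (tau : vocabulary).

(** A partial isomorphism is a list of pairs rather than a pair of tuples of the
    same length: a tuple over the pairs is then automatically a pair of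
    corresponding tuples, and only membership in the list matters. *)
Definition partial_iso (M N : eqType) (I : model A tau M) (J : model A tau N)
    (P : seq (M * N)) :=
  {in P &, forall a b, (a.1 == b.1) = (a.2 == b.2)} /\
  (forall (r : tau) (u : (arity r).-tuple (M * N)), {subset u <= P} ->
     I r [tuple of map fst u] = J r [tuple of map snd u]).

(** [p] prescribes how [x] sits over [e]; position 0 of [p] stands for [x] and
    position [i.+1] for the entry [i] of [e], repeated entries being read at
    their first occurrence. Only the tuples through [x] are
    constrained, so that for distinct [x] outside [e] the constraints concern
    disjoint sets of entries of the tables of [I]: this independence is what
    the counting argument uses. *)
Definition realizes (M : eqType) (I : model A tau M) (k : nat)
    (e : k.-tuple M) (p : fin_model A tau k.+1) (x : M) :=
  forall (r : tau) (u : (arity r).-tuple M), x \in u -> {subset u <= x :: e} ->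
    I r u = p r [tuple of map (fun y => inord (index y (x :: e))) u].

(** The extension axioms over [k] parameters. *)
Definition extendable (M : eqType) (I : model A tau M) (k : nat) :=
  forall (e : k.-tuple M) (p : fin_model A tau k.+1),
    exists2 x, x \notin e & realizes I e p x.

(** A quantifier whose body has [k.+1] free variables extends an assignment of
    length [k], so it calls for the extension axioms over [k] parameters;
    [width f] is a strict upper bound of these numbers [k]. *)
Fixpoint width (k : nat) (f : formula tau k) : nat :=
  match f with
  | FAtom _ _ _ | FZero _ | FOne _ => 0
  | FMeet _ f g | FJoin _ f g | FConj _ f g | FImp _ f g =>
      maxn (width f) (width g)
  | FForall k f | FExists k f => maxn k.+1 (width f)
  end.

Definition rich (M : eqType) (I : model A tau M) (K : nat) :=
  forall k, (k < K)%N -> extendable I k.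

Lemma rich_le (M : eqType) (I : model A tau M) (K L : nat) :
  (L <= K)%N -> rich I K -> rich I L.
Proof. by move=> LK IK k kL; apply: IK; apply: leq_trans LK. Qed.

Lemma partial_iso_swap (M N : eqType) (I : model A tau M) (J : model A tau N)
    (P : seq (M * N)) :
  partial_iso I J P -> partial_iso J I (map (fun a => (a.2, a.1)) P).
Proof.
move=> [Peq PI]; split.
  by move=> _ _ /mapP[a aP ->] /mapP[b bP ->] /=; rewrite Peq.
move=> r u uP; have := PI r [tuple of map (fun a => (a.2, a.1)) u].
have vP : {subset [tuple of map (fun a : N * M => (a.2, a.1)) u] <= P}.
  by move=> _ /mapP[a /uP/mapP[b bP ->] ->] /=; rewrite -surjective_pairing.
move=> /(_ vP) E; apply/esym; move: E.
by congr (I r _ = J r _); apply/val_inj => /=; rewrite -map_comp.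
Qed.

(** An element that already occurs keeps its partner. A new one has its type
    over the first components copied into a pattern [p], and the extension
    axiom of [J] provides a new element that realizes [p] over the second
    components. *)
Lemma partial_iso_forth (M N : eqType) (I : model A tau M)
    (J : model A tau N) (k : nat) (P : k.-tuple (M * N)) :
  extendable J k -> partial_iso I J P ->
  forall x, exists y, partial_iso I J ((x, y) :: P).
Proof.
move=> Jext [Peq PI] x.
have [/mapP[[x' y] xyP /= ->]|xP] := boolP (x \in map fst P).
  have inP : (x', y) :: P =i P.
    by move=> a; rewrite inE; case: eqP => // ->; rewrite xyP.
  exists y; split=> [a b|r u uP]; first by rewrite !inP; apply: Peq.
  by apply: PI => a /uP; rewrite inP.
pose e := [tuple of map snd P]; pose s := [tuple of x :: map fst P].
pose p : fin_model A tau k.+1 :=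
  [ffun r => [ffun t : (arity r).-tuple 'I_k.+1 =>
     I r [tuple of map (tnth s) t]]].
have [y yP yR] := Jext e p; exists y.
have eqs : {in (x, y) :: P &, forall a b, (a.1 == b.1) = (a.2 == b.2)}.
  have new a : a \in tval P -> ((x == a.1) = false) * ((y == a.2) = false).
    move=> aP; split; apply/eqP=> E.
      by move: xP; rewrite E map_f.
    by move: yP; rewrite E /= map_f.
  move=> a b; rewrite !inE => /predU1P[->|aP] /predU1P[->|bP] /=.
  - by rewrite !eqxx.
  - by rewrite !new.
  - by rewrite ![_.1 == _]eq_sym ![_.2 == _]eq_sym !new.
  - exact: Peq.
split=> // r u uP.
have [xyu|xyu] := boolP ((x, y) \in tval u); last first.
  apply: PI => a au; have /uP := au; rewrite inE => /predU1P[E|//].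
  by move: xyu; rewrite -E au.
have uy : y \in [tuple of map snd u] by apply: map_f xyu.
have uQ : {subset [tuple of map snd u] <= y :: e}.
  by move=> _ /mapP[a /uP aP ->]; apply: (map_f snd aP).
rewrite (yR r _ uy uQ) !ffunE; congr (I r _).
apply/val_inj => /=; rewrite -!map_comp.
apply/eq_in_map => a /uP aP /=.
(* the position of the second component points to the first component *)
set Q := (x, y) :: P in aP.
have iQ : (index a.2 (map snd Q) < size Q)%N.
  by rewrite -[ltnRHS](size_map snd) index_mem map_f.
rewrite -/(map snd Q) (tnth_nth x) inordK; last first.
  by move: iQ; rewrite /= size_tuple.
rewrite -[tval s]/(map fst Q).
rewrite (nth_map (x, y)) //; apply/eqP; rewrite eqs ?mem_nth //.
by rewrite -(nth_map _ y) // nth_index // map_f.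
Qed.

Lemma partial_iso_back (M N : eqType) (I : model A tau M)
    (J : model A tau N) (k : nat) (P : k.-tuple (M * N)) :
  extendable I k -> partial_iso I J P ->
  forall y, exists x, partial_iso I J ((x, y) :: P).
Proof.
move=> Iext /partial_iso_swap PJI y.
have [x /partial_iso_swap] := partial_iso_forth Iext PJI y.
rewrite /= -map_comp map_id_in; first by exists x.
by case.
Qed.

(** The back-and-forth argument. The set of values over which a quantifier takes
    its minimum or maximum is the same in both models, because each instance in
    one model has a matching instance in the other; the connectives may be
    arbitrary operations. *)
Lemma value_partial_iso (M N : eqType) (I : model A tau M)
    (J : model A tau N) (k : nat) (f : formula tau k) (P : k.-tuple (M * N)) :
  rich I (width f) -> rich J (width f) -> partial_iso I J P ->
  value I f [tuple of map fst P] = value J f [tuple of map snd P].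
Proof.
have ranges k' (g : formula tau k'.+1) (Q : k'.-tuple (M * N)) :
    (forall x y, partial_iso I J ((x, y) :: Q) ->
       value I g [tuple of x :: map fst Q] =
       value J g [tuple of y :: map snd Q]) ->
    rich I (maxn k'.+1 (width g)) -> rich J (maxn k'.+1 (width g)) ->
    partial_iso I J Q ->
    range (fun x => value I g [tuple of x :: map fst Q]) =
    range (fun y => value J g [tuple of y :: map snd Q]).
  move=> IH rI rJ PQ.
  have Ik : extendable I k' by apply: rI; rewrite leq_max leqnn.
  have Jk : extendable J k' by apply: rJ; rewrite leq_max leqnn.
  apply/seteqP; split=> a [z _ <-] /=.
    have [y yP] := partial_iso_forth Jk PQ z.
    by exists y => //; rewrite (IH z y).
  have [x xP] := partial_iso_back Ik PQ z.
  by exists x => //; rewrite (IH x z).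
have width2 K L :
    rich I (maxn K L) -> rich J (maxn K L) ->
    (rich I K * rich J K) * (rich I L * rich J L).
  by move=> rI rJ; split; split; (apply: rich_le; last eassumption);
     rewrite leq_max leqnn ?orbT.
elim: f P => {k} [k r t|k f IHf g IHg|k f IHf g IHg|k f IHf g IHg
  |k f IHf g IHg|k|k|k f IHf|k f IHf] P /=.
2-5: by move=> rI rJ PP; have [[]] := width2 _ _ rI rJ => ? ? [? ?];
  rewrite IHf // IHg.
- move=> _ _ [_ PI].
  have /PI : {subset [tuple of map (tnth P) t] <= P}.
    by move=> _ /mapP[i _ ->]; apply: mem_tnth.
  congr (I r _ = J r _); apply/val_inj => /=;
    by rewrite -map_comp; apply/eq_map => i /=; rewrite tnth_map.
- by [].
- by [].
- move=> rI rJ PP; congr (least _).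
  apply: ranges => // x y xyP; have [_ [rI' rJ']] := width2 _ _ rI rJ.
  have := IHf [tuple of (x, y) :: P] rI' rJ' xyP.
  by congr (value I f _ = value J f _); apply/val_inj.
- move=> rI rJ PP; congr (greatest _).
  apply: ranges => // x y xyP; have [_ [rI' rJ']] := width2 _ _ rI rJ.
  have := IHf [tuple of (x, y) :: P] rI' rJ' xyP.
  by congr (value I f _ = value J f _); apply/val_inj.
Qed.

(** The empty list is a partial isomorphism because the arities are positive:
    there are no atomic sentences on which the two models could differ. *)
Lemma sentence_value_rich (M N : eqType) (I : model A tau M)
    (J : model A tau N) (f : sentence tau) :
  rich I (width f) -> rich J (width f) ->
  sentence_value I f = sentence_value J f.
Proof.
move=> rI rJ.
have nilI : partial_iso I J [tuple].
  split=> // r u uP.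
  have := uP (tnth u (Ordinal (arity_gt0 r))).
  by rewrite mem_tnth => /(_ isT).
have := value_partial_iso rI rJ nilI.
by congr (value I f _ = value J f _); apply/val_inj.
Qed.

End PartialIsomorphism.

(** * Counting the models that omit a pattern *)

Section Resampling.
Variables (R : realType) (A : algebra R) (tau : vocabulary).

Lemma fin_model_gt0 (m : nat) : (0 < #|{: fin_model A tau m}|)%N.
Proof.
by apply/card_gt0P; exists [ffun r => [ffun=> alg_one A]].
Qed.

Section OnePattern.
Variables (m k : nat) (e : k.-tuple 'I_m) (p : fin_model A tau k.+1).

Definition unrealized (X : seq 'I_m) : {set fin_model A tau m} :=
  [set I | all (fun x => `[< ~ realizes (model_of I) e p x >]) X]%SET.

(** Besides what [resample x] erases, this records the tuples inside [e]; the
    redundancy lets it have the type of a pattern. *)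
Definition local_type (x : 'I_m) (I : fin_model A tau m) :
    fin_model A tau k.+1 :=
  [ffun r => [ffun t : (arity r).-tuple 'I_k.+1 =>
     I r [tuple of map (tnth [tuple of x :: e]) t]]].

Definition resample (x : 'I_m) (I : fin_model A tau m) : fin_model A tau m :=
  [ffun r => [ffun u : (arity r).-tuple 'I_m =>
     if (x \in u) && all (mem (x :: e)) u
     then p r [tuple of map (fun y => inord (index y (x :: e))) u]
     else I r u]].

Lemma resample_realizes (x : 'I_m) (I : fin_model A tau m) :
  realizes (model_of (resample x I)) e p x.
Proof.
move=> r u xu /allP ue; rewrite /model_of !ffunE xu.
by have -> : all (mem (x :: e)) u by exact: ue.
Qed.

(** Resampling at [x] changes only tuples through [x], while a constraint at
    some [y] different from [x] concerns tuples inside [y :: e]. *)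
Lemma resample_unrealized (x : 'I_m) (X : seq 'I_m) (I : fin_model A tau m) :
  x \notin e -> x \notin X ->
  I \in unrealized X -> resample x I \in unrealized X.
Proof.
move=> xe xX; rewrite !inE => /allP IX; apply/allP => y yX.
have /asboolP nIy := IX y yX; apply/asboolP => Iy; apply: nIy.
move=> r u yu ue; rewrite -(Iy r u yu ue) /model_of !ffunE ifF //.
apply/negbTE/negP => /andP[xu _].
have := ue x xu; rewrite inE (negbTE xe) orbF => /eqP xy.
by rewrite xy yX in xX.
Qed.

Lemma resample_inj (x : 'I_m) :
  injective (fun I => (resample x I, local_type x I)).
Proof.
move=> I J [] /ffunP EIJ /ffunP LIJ; apply/ffunP => r; apply/ffunP => u.
have := EIJ r; rewrite !ffunE => /ffunP/(_ u); rewrite !ffunE.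
case: ifP => // /andP[_ ue] _.
have := LIJ r; rewrite !ffunE.
move=> /ffunP/(_ [tuple of map (fun y => inord (index y (x :: e))) u]).
rewrite !ffunE.
suff -> : [tuple of map (tnth [tuple of x :: e])
   [tuple of map (fun y => inord (index y (x :: e))) u]] = u by [].
apply/val_inj; rewrite /= -map_comp; apply: map_id_in => y yu.
have /= ye : y \in x :: e by have /allP := ue; apply.
have lt : (index y (x :: e) < k.+1)%N.
  by move: ye; rewrite -index_mem /= size_tuple.
by rewrite [LHS](tnth_nth x) inordK // nth_index.
Qed.

(** Writing U for [unrealized X] and Q for the number of patterns, resampling
    together with the local type injects U into the product of the part of U
    where [x] realizes [p] with the set of patterns. Hence that part has at
    least |U| / Q elements, and deleting it from U leaves the models in which
    [x] fails as well. *)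
Lemma card_unrealized_cons (x : 'I_m) (X : seq 'I_m) :
  x \notin e -> x \notin X ->
  (#|unrealized (x :: X)| * #|{: fin_model A tau k.+1}| + #|unrealized X|
     <= #|unrealized X| * #|{: fin_model A tau k.+1}|)%N.
Proof.
move=> xe xX.
pose Rx := [set I : fin_model A tau m |
  `[< realizes (model_of I) e p x >]]%SET.
have UD : unrealized (x :: X) = unrealized X :\: Rx.
  by apply/setP => I; rewrite !inE /= asbool_neg andbC.
rewrite UD -[leqRHS]/(_ * _)%N -(cardsID Rx (unrealized X)) mulnDl addnC.
rewrite cardsID leq_add2r -cardsT -cardsX -(card_imset _ (@resample_inj x)).
apply/subset_leq_card/fintype.subsetP => _ /imsetP[I IX ->].
rewrite !inE /= andbT; move: (resample_unrealized xe xX IX).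
rewrite inE => ->; apply/asboolP.
exact: resample_realizes.
Qed.

(** Each candidate outside [e] removes at least a fixed fraction of the models
    that remain, so the failures become exponentially rare. *)
Lemma card_unrealized (X : seq 'I_m) :
  uniq X -> {in X, forall x, x \notin e} ->
  #|unrealized X|%:R <=
    (1 - #|{: fin_model A tau k.+1}|%:R^-1) ^+ size X
      * #|{: fin_model A tau m}|%:R :> R.
Proof.
set Q := #|{: fin_model A tau k.+1}|.
have Q0 : 0 < Q%:R :> R by rewrite ltr0n fin_model_gt0.
have Q1 : 0 <= 1 - Q%:R^-1 :> R.
  by rewrite subr_ge0 invf_le1 // ler1n fin_model_gt0.
elim: X => [|x X IH] /=; first by rewrite mul1r ler_nat max_card.
move=> /andP[xX uX] Xe.
have {}IH := IH uX (fun y yX => Xe y (mem_behead (s := x :: X) yX)).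
rewrite exprS -mulrA; apply: le_trans (ler_wpM2l Q1 IH).
have := card_unrealized_cons (Xe x (mem_head x X)) xX.
rewrite -(ler_nat R) natrD !natrM -/Q => H.
rewrite -(ler_pM2r Q0) mulrBl mul1r mulrBl mulrAC mulVf ?gt_eqF // mul1r.
by rewrite lerBrDr.
Qed.

End OnePattern.
End Resampling.

(** * Exponential decay beats polynomial growth *)

Lemma bernoulli_inequality (R : realFieldType) (u : R) (n : nat) :
  0 <= u <= 1 -> 1 - n%:R * u <= (1 - u) ^+ n.
Proof.
move=> /andP[u0 u1]; elim: n => [|n IH]; first by rewrite mul0r subr0 expr0.
have n0 : 0 <= n%:R :> R by [].
rewrite exprS -natr1.
have : (1 - u) * (1 - n%:R * u) <= (1 - u) * (1 - u) ^+ n.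
  by rewrite ler_wpM2l // subr_ge0.
by nra.
Qed.

(** The sum of the [d ^+ i] for [i < m] is [(1 - d ^+ m) / (1 - d)], and each of
    its terms is at least [d ^+ m]. *)
Lemma natr_expr_bounded (R : realFieldType) (d : R) (m : nat) :
  0 < d < 1 -> m%:R * d ^+ m <= (1 - d)^-1.
Proof.
move=> /andP[d0 d1].
have d1' : 0 < 1 - d by rewrite subr_gt0.
rewrite -[leRHS]mul1r ler_pdivlMr //.
suff : m%:R * d ^+ m * (1 - d) <= 1 - d ^+ m.
  by move=> /le_trans; apply; rewrite gerBl exprn_ge0 // ltW.
elim: m => [|m IH]; first by rewrite !mul0r expr0 subrr.
rewrite exprS -natr1.
have : d * (m%:R * d ^+ m * (1 - d)) <= d * (1 - d ^+ m) by rewrite ler_pM2l.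
have : 0 <= d ^+ m <= 1 by rewrite exprn_ge0 ?exprn_ile1 // ltW.
move: (d ^+ m) => q /andP[q0 q1]; move: (m%:R) => n IHd.
have : 0 <= (1 - d) * (1 - d * q).
  by rewrite mulr_ge0 ?subr_ge0 ?mulr_ile1 // ltW.
by nra.
Qed.

(** Choosing [d < 1] with [c <= d ^+ k.+1] bounds the general term by a
    product of [k] bounded factors [m%:R * d ^+ m] and one geometric factor
    [d ^+ m]. *)
Lemma cvg_natr_expr (R : realType) (k : nat) (c : R) :
  0 < c < 1 -> m%:R ^+ k * c ^+ m @[m --> \oo] --> (0 : R).
Proof.
move=> /andP[c0 c1].
(* Bernoulli's inequality gives d ^+ k.+1 >= 1 - k.+1 * u = c *)
pose u : R := (1 - c) / k.+1%:R; pose d := 1 - u.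
have k0 : 0 < k.+1%:R :> R by [].
have k1 : 1 <= k.+1%:R :> R by rewrite ler1n.
have u0 : 0 < u by rewrite divr_gt0 // subr_gt0.
have u1 : u < 1 by rewrite ltr_pdivrMr // mul1r; lra.
have d01 : 0 < d < 1 by rewrite /d; apply/andP; split; lra.
have [d0 d1] := andP d01.
have cd : c <= d ^+ k.+1.
  apply: le_trans (bernoulli_inequality k.+1 _); last by rewrite !ltW.
  by rewrite mulrC divfK ?gt_eqF //; lra.
apply: (@squeeze_cvgr _ _ _ _ (fun=> 0) (fun m => ((1 - d)^-1) ^+ k * d ^+ m)).
- near=> m; apply/andP; split.
    by rewrite mulr_ge0 // exprn_ge0 // ltW.
  apply: (@le_trans _ _ (m%:R ^+ k * (d ^+ k.+1) ^+ m)).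
    by rewrite ler_wpM2l ?exprn_ge0 // lerXn2r // nnegrE ?exprn_ge0 // ltW.
  rewrite -exprM mulSn exprD mulrCA [leRHS]mulrC.
  rewrite ler_wpM2l ?exprn_ge0 ?(ltW d0) //.
  rewrite mulnC exprM -exprMn lerXn2r // ?nnegrE.
  - by rewrite mulr_ge0 // exprn_ge0 // ltW.
  - by rewrite invr_ge0 subr_ge0 ltW.
  - exact: natr_expr_bounded.
- exact: cvg_cst.
- by apply: cvg_geometric; rewrite ger0_norm // ltW.
Unshelve. all: by end_near. Qed.

(** * Almost all finite models are rich *)

Lemma card_union_bound (T I : finType) (S : {set T}) (U : I -> {set T}) :
  (forall x, x \in S -> exists i, x \in U i) -> (#|S| <= \sum_i #|U i|)%N.
Proof.
move=> SU; apply: (@leq_trans #|(\bigcup_i U i)%SET|).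
  apply/subset_leq_card/fintype.subsetP => x /SU[i xi].
  by apply/finset.bigcupP; exists i.
elim/big_rec2: _ => [|i n V _ Vn]; first by rewrite cards0.
by rewrite (leq_trans (leq_card_setU _ _).1) ?leq_add2l.
Qed.

Section AlmostSureRichness.
Variables (R : realType) (A : algebra R) (tau : vocabulary).

Definition proportion (m : nat) (P : fin_model A tau m -> Prop) : R :=
  #|[set I | `[< P I >]]%SET|%:R / #|{: fin_model A tau m}|%:R.

Lemma proportion_ge0 (m : nat) (P : fin_model A tau m -> Prop) :
  0 <= proportion P.
Proof. by rewrite divr_ge0. Qed.

Lemma proportionC (m : nat) (P : fin_model A tau m -> Prop) :
  proportion P = 1 - proportion (fun I => ~ P I).
Proof.
have T0 : #|{: fin_model A tau m}|%:R != 0 :> R.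
  by rewrite pnatr_eq0 -lt0n fin_model_gt0.
apply/eqP; rewrite eq_sym subr_eq -mulrDl -natrD; apply/eqP.
rewrite -(cardsC [set I | `[< P I >]]%SET) /proportion.
have -> : [set I | `[< ~ P I >]]%SET = (~: [set I | `[< P I >]])%SET.
  by apply/setP => I; rewrite !inE asbool_neg.
by rewrite divff // cardsC.
Qed.

Lemma proportion_le (m : nat) (P Q : fin_model A tau m -> Prop) :
  (forall I, P I -> Q I) -> proportion P <= proportion Q.
Proof.
move=> PQ; rewrite ler_wpM2r ?invr_ge0 // ler_nat.
apply/subset_leq_card/fintype.subsetP => I.
by rewrite !inE; exact: PQ.
Qed.

Lemma proportion_or (m : nat) (P Q S : fin_model A tau m -> Prop) :
  (forall I, P I -> Q I \/ S I) ->
  proportion P <= proportion Q + proportion S.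
Proof.
move=> PQ; rewrite -mulrDl ler_wpM2r ?invr_ge0 // -natrD ler_nat.
apply: leq_trans (leq_card_setU _ _).1.
apply/subset_leq_card/fintype.subsetP => I.
by rewrite !inE => /PQ[QI|SI]; apply/orP; [left|right]; apply/asboolP.
Qed.

(** Union bound over the [m ^ k] parameter tuples and the patterns; each pair
    leaves at least [m - k] candidates. The base [c] is a parameter so that it
    can be taken positive, which allows the exponent [m - k] to be traded for
    the factor [c ^+ m / c ^+ k]. *)
Lemma proportion_not_extendable (m k : nat) (c : R) :
  1 - #|{: fin_model A tau k.+1}|%:R^-1 <= c -> 0 < c <= 1 ->
  proportion (fun I : fin_model A tau m => ~ extendable (model_of I) k) <=
    #|{: fin_model A tau k.+1}|%:R / c ^+ k * (m%:R ^+ k * c ^+ m).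
Proof.
set Q := #|{: fin_model A tau k.+1}|.
move=> Qc /andP[c0 c1].
have T0 : 0 < #|{: fin_model A tau m}|%:R :> R by rewrite ltr0n fin_model_gt0.
rewrite ler_pdivrMr //.
pose X (e : k.-tuple 'I_m) := enum [predC e].
pose U (ep : k.-tuple 'I_m * fin_model A tau k.+1) :=
  unrealized ep.1 ep.2 (X ep.1).
have := @card_union_bound _ _
  [set I : fin_model A tau m | `[< ~ extendable (model_of I) k >]]%SET U.
rewrite -(ler_nat R) => /(_ _)/le_trans -> //.
  move=> I; rewrite inE => /asboolP nI; apply: contrapT => nU; apply: nI.
  move=> e p; apply: contrapT => nx; apply: nU; exists (e, p).
  rewrite inE; apply/allP => x; rewrite mem_enum inE /= => xe.
  by apply/asboolP => xp; apply: nx; exists x.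
apply: (@le_trans _ _ (\sum_(ep : k.-tuple 'I_m * fin_model A tau k.+1)
    c ^+ m / c ^+ k * #|{: fin_model A tau m}|%:R)).
  rewrite natr_sum; apply: ler_sum => -[e p] _.
  apply: le_trans (card_unrealized p (enum_uniq _) _) _ => [x|].
    by rewrite mem_enum.
  rewrite ler_wpM2r ?(ltW T0) // ler_pdivlMr ?exprn_gt0 //.
  apply: (@le_trans _ _ (c ^+ size (X e) * c ^+ k)).
    rewrite ler_wpM2r ?exprn_ge0 ?(ltW c0) // lerXn2r // nnegrE ?(ltW c0) //.
    by rewrite subr_ge0 invf_le1 ?ltr0n ?ler1n fin_model_gt0.
  rewrite -exprD ler_wiXn2l ?(ltW c0) //.
  rewrite -[leqLHS]card_ord -(cardC (mem e)) addnC -cardE leq_add2l.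
  by rewrite (leq_trans (card_size _)) // size_tuple.
rewrite sumr_const card_prod card_tuple card_ord -/Q.
rewrite -[X in X <= _]mulr_natl natrM natrX.
by rewrite le_eqVlt; apply/orP; left; apply/eqP; ring.
Qed.

Lemma cvg_not_extendable (k : nat) :
  proportion (fun I : fin_model A tau m => ~ extendable (model_of I) k)
    @[m --> \oo] --> (0 : R).
Proof.
set Q := #|{: fin_model A tau k.+1}|.
have Q0 : (0 < Q)%N := fin_model_gt0 A tau k.+1.
(* with Q in place of Q.+1 this would vanish when there is a single pattern *)
pose c : R := 1 - Q.+1%:R^-1.
have c01 : 0 < c < 1.
  by rewrite subr_gt0 invf_lt1 ?ltr0n // ltr1n ltnS Q0 gtrBl invr_gt0 ltr0n.
have Qc : 1 - Q%:R^-1 <= c.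
  by rewrite lerD2l lerN2 lef_pV2 ?posrE ?ltr0n // ler_nat.
apply: (@squeeze_cvgr _ _ _ _ (fun=> 0)
  (fun m => Q%:R / c ^+ k * (m%:R ^+ k * c ^+ m))).
- near=> m; rewrite proportion_ge0 /=.
  have [c0 c1] := andP c01.
  by apply: proportion_not_extendable; rewrite // c0 ltW.
- exact: cvg_cst.
- rewrite -[X in _ --> X](mulr0 (Q%:R / c ^+ k)).
  by apply: cvgMr; exact: cvg_natr_expr.
Unshelve. all: by end_near. Qed.

Lemma cvg_not_rich (K : nat) :
  proportion (fun I : fin_model A tau m => ~ rich (model_of I) K)
    @[m --> \oo] --> (0 : R).
Proof.
elim: K => [|K IH].
  apply: (@squeeze_cvgr _ _ _ _ (fun=> 0) (fun=> 0)); try exact: cvg_cst.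
  near=> m; rewrite proportion_ge0 /=.
  rewrite /proportion (_ : [set I | _]%SET = finset.set0) ?cards0 ?mul0r //.
  by apply/setP => I; rewrite !inE; apply/asboolP; apply.
apply: (@squeeze_cvgr _ _ _ _ (fun=> 0) (fun m =>
  proportion (fun I : fin_model A tau m => ~ rich (model_of I) K) +
  proportion (fun I : fin_model A tau m => ~ extendable (model_of I) K))).
- near=> m; rewrite proportion_ge0 /=; apply: proportion_or => I nI.
  apply/not_andP => -[rI eI]; apply: nI => k.
  by rewrite ltnS leq_eqVlt => /predU1P[->//|]; apply: rI.
- exact: cvg_cst.
- rewrite -[X in _ --> X](addr0 0); apply: cvgD => //.
  exact: cvg_not_extendable.
Unshelve. all: by end_near. Qed.

(** A single finite rich model serves as reference for all the others, in place
    of an infinite generic structure. *)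
Lemma exists_rich (K : nat) :
  exists (m : nat) (I : fin_model A tau m), rich (model_of I) K.
Proof.
have /cvgr_lt/(_ 1 ltr01)[m _ /(_ m (leqnn m)) /= lt1] := cvg_not_rich K.
exists m; apply: contrapT => nI; move: lt1; rewrite ltNge => /negP; apply.
rewrite /proportion (_ : [set I | _]%SET = finset.setT) ?cardsT.
  by rewrite divff // pnatr_eq0 -lt0n fin_model_gt0.
apply/setP => I; rewrite !inE; apply/asboolP => rI.
by apply: nI; exists I.
Qed.

Definition md_width (s : md_sentence A tau) : nat :=
  \max_(i < md_size s) width (tnth (md_components s) i).

Lemma satisfies_rich (M N : eqType) (I : model A tau M) (J : model A tau N)
    (s : md_sentence A tau) :
  rich I (md_width s) -> rich J (md_width s) -> satisfies I s = satisfies J s.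
Proof.
move=> rI rJ; rewrite /satisfies; apply: (congr1 (fun v => v \in md_values s)).
apply/eq_from_tnth => i; rewrite !tnth_map.
have iw : (width (tnth (md_components s) i) <= md_width s)%N.
  exact: leq_bigmax.
by apply: sentence_value_rich; apply: rich_le iw _.
Qed.

Lemma fractionE (s : md_sentence A tau) (m : nat) :
  fraction s m =
  proportion (fun I : fin_model A tau m => satisfies (model_of I) s).
Proof.
rewrite /fraction /proportion; congr (_%:R / _).
by apply: eq_card => I; rewrite !inE asboolb.
Qed.

End AlmostSureRichness.


Theorem theorem22 (R : realType) (A : algebra R) (tau : vocabulary)
    (s : md_sentence A tau) :
  almost_surely_satisfied s \/ almost_surely_not_satisfied s.
Proof.
have [m0 [J rJ]] := exists_rich A tau (md_width s).
have notrich := cvg_not_rich A tau (md_width s).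
rewrite /almost_surely_satisfied /almost_surely_not_satisfied.
rewrite (funext (fractionE s)).
have [Js|Js] := boolP (satisfies (model_of J) s); [left|right].
- apply: (@squeeze_cvgr _ _ _ _ (fun m => 1 -
    proportion (fun I : fin_model A tau m => ~ rich (model_of I) (md_width s)))
    (fun=> 1)).
  2: by rewrite -[X in _ --> X]subr0; exact: cvgB (cvg_cst _) _.
  2: exact: cvg_cst.
  near=> m; rewrite -proportionC; apply/andP; split.
    by apply: proportion_le => I rI; rewrite (satisfies_rich rI rJ).
  by rewrite proportionC gerBl proportion_ge0.
- apply: (@squeeze_cvgr _ _ _ _ (fun=> 0) _ _ _ _ (cvg_cst _) notrich).
  near=> m; rewrite proportion_ge0 /=; apply: proportion_le => I Is rI.
  by move: Js; rewrite -(satisfies_rich rI rJ) Is.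
Unshelve. all: by end_near. Qed.
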